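(* The deformation cone $\operatorname{Def}(\mathrm{Br}_d^2)\subseteq\mathbb{R}^{\overline{\mathcal{O}_{d+1}}}$ of the nested Braid fan is the set of all $\mathbf{b}\in\mathbb{R}^{\overline{\mathcal{O}_{d+1}}}$ satisfying the following two conditions, where we set $b_{\hat 1}=b_{[d+1]}=0$: (1) (Local submodularity) for every $\pi\in\mathfrak{S}_{d+1}$ and all $\mathcal{S},\mathcal{T}$ in the interval $[\mathcal{T}(\pi),\hat 1]$ of $\mathcal{O}_{d+1}$, $b_{\mathcal{S}\vee\mathcal{T}}+b_{\mathcal{S}\wedge\mathcal{T}}\le b_{\mathcal{S}}+b_{\mathcal{T}}$ (join and meet taken in this interval, which is a Boolean lattice); (2) (Essential inequalities) for every rank-$1$ element $\mathcal{T}=s_1|s_2|\cdots|s_{i-1}|s_is_i'|s_{i+1}|\cdots|s_d$ of $\mathcal{O}_{d+1}$ (all blocks singletons except the $i$-th block $\{s_i,s_i'\}$), letting $\mathcal{T}_0=s_1|\cdots|s_{i-1}|s_i|s_i'|s_{i+1}|\cdots|s_d$, $\mathcal{T}_0'=s_1|\cdots|s_{i-1}|s_i'|s_i|s_{i+1}|\cdots|s_d$, and $\mathcal{S}=s_1s_2\cdots s_{i-1}\,|\,s_is_i'\,|\,s_{i+1}\cdots s_d$ (the ordered partition into the blocks $\{s_1,\dots,s_{i-1}\}$, $\{s_i,s_i'\}$, $\{s_{i+1},\dots,s_d\}$, with empty blocks omitted), one has $2b_{\mathcal{T}}+b_{\mathcal{S}}\le b_{\mathcal{T}_0}+b_{\mathcal{T}_0'}+b_{[d+1]}$,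 where the term $b_{[d+1]}$ is omitted when $i=1$.
   Context: Let $V_d=\{\mathbf{x}\in\mathbb{R}^{d+1}:\sum x_i=0\}$, $W_d=\mathbb{R}^{d+1}/\mathbb{R}\mathbf{1}$, paired by $\langle\mathbf{w},\mathbf{x}\rangle=\sum w_ix_i$. An ordered set partition of $[d+1]$ is a tuple $(S_1,\dots,S_k)$ of nonempty disjoint sets with union $[d+1]$, written $S_1|S_2|\cdots|S_k$; $\mathcal{O}_{d+1}$ is the poset of ordered set partitions ordered by refinement ($\mathcal{S}\le\mathcal{T}$ iff $\mathcal{T}$ is obtained from $\mathcal{S}$ by merging consecutive blocks); its rank function is $(d+1)-\#\text{blocks}$, its maximum is $\hat1=([d+1])$, and $\overline{\mathcal{O}_{d+1}}=\mathcal{O}_{d+1}\setminus\{\hat 1\}$. For $\pi\in\mathfrak{S}_{d+1}$, $\mathcal{T}(\pi)=\{\pi^{-1}(1)\}|\cdots|\{\pi^{-1}(d+1)\}$. For $\mathcal{T}=S_1|\cdots|S_k$ let $\mathbf{e}_{\mathcal{T}}=\sum_i i\sum_{j\in S_i}\mathbf{e}_j$. For $(\pi,\tau)\in\mathfrak{S}_{d+1}\times\mathfrak{S}_d$, let $\sigma(\pi,\tau)$ be the set of $\mathbf{x}\in W_d$ with $x_{\pi^{-1}(1)}\le\cdots\le x_{\pi^{-1}(d+1)}$ and $(\Delta\mathbf{x})^\pi_{\tau^{-1}(1)}\le\cdots\le(\Delta\mathbf{x})^\pi_{\tau^{-1}(d)}$, where $(\Delta\mathbf{x})^\pi_i=x_{\pi^{-1}(i+1)}-x_{\pi^{-1}(i)}$;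 the nested Braid fan $\mathrm{Br}_d^2$ consists of these cones and their faces. It is a complete simplicial projective fan whose rays are the $\mathbf{e}_{\mathcal{T}}$, $\mathcal{T}\in\overline{\mathcal{O}_{d+1}}$. Deformations: for a full-dimensional polytope $P_0\subset V_d$ with facets $F_1,\dots,F_m$ and outer normals $\mathbf{a}_i\in W_d$, a vector $\mathbf{b}\in\mathbb{R}^m$ is a deforming vector if, for $Q_{\mathbf{b}}=\{\mathbf{x}:\langle\mathbf{a}_i,\mathbf{x}\rangle\le b_i\ \forall i\}$, for every vertex $v$ of $P_0$ lying exactly on facets $F_{i_1},\dots,F_{i_k}$ the intersection of the hyperplanes $\langle\mathbf{a}_{i_j},\mathbf{x}\rangle=b_{i_j}$ ($1\le j\le k$) is a vertex of $Q_{\mathbf{b}}$; $\operatorname{Def}(P_0)$ is the set of deforming vectors. $\operatorname{Def}(\mathrm{Br}_d^2)$ denotes $\operatorname{Def}(P_0)$ for any full-dimensional polytope $P_0\subset V_d$ with normal fan $\mathrm{Br}_d^2$, where the facet with outer normal $\mathbf{e}_{\mathcal{T}}$ is indexed by $\mathcal{T}\in\overline{\mathcal{O}_{d+1}}$ (this does not depend on the choice of $P_0$). *)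

(* Defs.v *)
From HB Require Import structures.
From mathcomp Require Import all_boot all_order all_fingroup all_algebra.
From mathcomp Require Import classical_sets reals.

Set Implicit Arguments.
Unset Strict Implicit.
Unset Printing Implicit Defensive.

Import Order.TTheory GRing.Theory Num.Theory.
Local Open Scope ring_scope.

(* Throughout, [d + 1] = {1, ..., d + 1} is represented by 'I_d.+1, so element
   and position numbers are shifted down by one. *)

Section OrderedSetPartitions.
Variable n : nat.

Definition is_osp (s : seq {set 'I_n}) : bool :=
  [&& finset.set0 \notin s, pairwise (fun A B : {set 'I_n} => [disjoint A & B]) s
    & (\bigcup_(B <- s) B)%SET == [set: 'I_n]%SET].

Record osp := Osp { blocks :> seq {set 'I_n}; ospP : is_osp blocks }.

HB.instance Definition _ := [isSub for blocks].
HB.instance Definition _ := [Choice of osp by <:].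

Definition osp_rank (T : osp) : nat := (n - size T)%N.

(* [ss] groups the blocks of [S] into runs of consecutive blocks; a run cannot
   be empty, since its union would be an empty block of [T]. *)
Definition osp_le (S T : osp) : Prop :=
  exists ss : seq (seq {set 'I_n}),
    flatten ss = S /\ [seq (\bigcup_(B <- s) B)%SET | s <- ss] = T.

Lemma perm_blocks_osp (pi : 'S_n) :
  is_osp [seq [set (pi^-1)%g i]%SET | i <- enum 'I_n].
Proof.
apply/and3P; split.
- apply/negP => /mapP[i _] /esym/eqP.
  by rewrite -finset.subset0 finset.sub1set finset.inE.
- rewrite pairwise_map; have := enum_uniq 'I_n; rewrite uniq_pairwise.
  apply: sub_pairwise => i j ij /=.
  by rewrite disjoints1 finset.inE (inj_eq perm_inj).
- apply/eqP/finset.setP => x; rewrite finset.inE big_map.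
  rewrite finset.bigcup_seq; apply/finset.bigcupP; exists (pi x).
    by rewrite mem_enum.
  by rewrite permK finset.set11.
Qed.

Definition osp_of_perm (pi : 'S_n) : osp := Osp (perm_blocks_osp pi).

End OrderedSetPartitions.

Lemma top_blocks_osp d : is_osp [:: [set: 'I_d.+1]%SET].
Proof.
apply/and3P; split=> //; last by rewrite big_seq1.
rewrite mem_seq1; apply/eqP => /finset.setP /(_ ord0).
by rewrite !finset.inE.
Qed.

Definition osp_top d : osp d.+1 := Osp (top_blocks_osp d).

Definition osp_bar d := {T : osp d.+1 | T != osp_top d}.

Section Intervals.
Variables (d : nat) (pi : 'S_d.+1).

Definition in_interval (S : osp d.+1) : Prop :=
  osp_le (osp_of_perm pi) S /\ osp_le S (osp_top d).

Definition is_join (S T J : osp d.+1) : Prop :=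
  [/\ in_interval J, osp_le S J, osp_le T J
    & forall U, in_interval U -> osp_le S U -> osp_le T U -> osp_le J U].

Definition is_meet (S T M : osp d.+1) : Prop :=
  [/\ in_interval M, osp_le M S, osp_le M T
    & forall U, in_interval U -> osp_le U S -> osp_le U T -> osp_le U M].

End Intervals.

(* Elements of W_d = R^(d+1) / R1 are represented by vectors of R^(d+1), and a
   subset of W_d by its preimage in R^(d+1), which is invariant under adding
   multiples of 1.  All subsets of W_d below have this invariance, because they
   are cut out by pairings with elements of V_d or by differences of
   coordinates. *)
Section Polyhedra.
Local Open Scope classical_set_scope.
Variables (R : realType) (d : nat).
Local Notation vec := 'rV[R]_d.+1.

Definition Vd : set vec := [set x : vec | \sum_i x 0 i = 0].

Definition pairing (w x : vec) : R := \sum_i w 0 i * x 0 i.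

Definition is_polytope (P : set vec) : Prop :=
  P `<=` Vd /\
  exists (m : nat) (p : 'I_m -> vec),
    P = [set x : vec | exists l : 'I_m -> R,
          [/\ forall i, 0 <= l i, \sum_i l i = 1 & x = \sum_i l i *: p i]].

Definition affine_hull (P : set vec) : set vec :=
  [set x : vec | exists (m : nat) (p : 'I_m -> vec) (l : 'I_m -> R),
    [/\ forall i, P (p i), \sum_i l i = 1 & x = \sum_i l i *: p i]].

Definition full_dimensional (P : set vec) : Prop := affine_hull P = Vd.

(* The set of maximizers on [P] of the functional [w]. *)
Definition face_in_direction (P : set vec) (w : vec) : set vec :=
  [set x : vec | P x /\ forall y, P y -> pairing w y <= pairing w x].

Definition is_face (P F : set vec) : Prop :=
  F !=set0 /\ exists w, F = face_in_direction P w.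

Definition is_vertex (P : set vec) (v : vec) : Prop := is_face P [set v].

Definition normal_cone (P F : set vec) : set vec :=
  [set w : vec | forall x y, F x -> P y -> pairing w y <= pairing w x].

Definition normal_fan (P : set vec) : set (set vec) :=
  [set C | exists2 F, is_face P F & C = normal_cone P F].

(* Faces of a cone [C] in W_d, cut out by functionals in V_d, the dual of W_d. *)
Definition is_cone_face (C D : set vec) : Prop :=
  exists x, [/\ Vd x, forall w, C w -> pairing w x <= 0
              & D = [set w : vec | C w /\ pairing w x = 0]].

(* Deforming vectors.  The family [a] lists the outer normals of the facets of
   [P], so that the facet with normal [a i] is [face_in_direction P (a i)]. *)
Section Deformations.
Variables (I : Type) (a : I -> vec).

Definition Qpoly (b : I -> R) : set vec :=
  [set x : vec | Vd x /\ forall i, pairing (a i) x <= b i].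

Definition is_deforming (P : set vec) (b : I -> R) : Prop :=
  forall v, is_vertex P v ->
    exists2 u, is_vertex (Qpoly b) u &
      [set x : vec | Vd x /\
         forall i, face_in_direction P (a i) v -> pairing (a i) x = b i]
      = [set u].

Definition deformation_cone (P : set vec) : set (I -> R) :=
  [set b | is_deforming P b].

End Deformations.

Definition osp_vec (T : osp d.+1) : vec :=
  \sum_(i < size T) i.+1%:R *: \sum_(j in nth finset.set0 T i) delta_mx 0 j.

(* Here [lift ord0 i] and [widen_ord _ i] are i + 1 and i in 'I_d.+1. *)
Definition gap (pi : 'S_d.+1) (x : vec) (i : 'I_d) : R :=
  x 0 ((pi^-1)%g (lift ord0 i)) - x 0 ((pi^-1)%g (widen_ord (leqnSn d) i)).

Definition nested_braid_cone (pi : 'S_d.+1) (tau : 'S_d) : set vec :=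
  [set x : vec | (forall i j : 'I_d.+1, (i <= j)%N ->
              x 0 ((pi^-1)%g i) <= x 0 ((pi^-1)%g j)) /\
           (forall i j : 'I_d, (i <= j)%N ->
              gap pi x ((tau^-1)%g i) <= gap pi x ((tau^-1)%g j))].

Definition nested_braid_fan : set (set vec) :=
  [set C | exists pi tau, is_cone_face (nested_braid_cone pi tau) C].

(* The extension of [b] by the value 0 at the top element [d + 1]. *)
Definition bext (b : osp_bar d -> R) (T : osp d.+1) : R :=
  oapp b 0 (insub T).

Definition local_submodularity (b : osp_bar d -> R) : Prop :=
  forall (pi : 'S_d.+1) (S T J M : osp d.+1),
    in_interval pi S -> in_interval pi T ->
    is_join pi S T J -> is_meet pi S T M ->
    bext b J + bext b M <= bext b S + bext b T.

(* With p = s_1 ... s_(i-1) and q = s_(i+1) ... s_d, the case i = 1 is p = [::]. *)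
Definition essential_inequalities (b : osp_bar d -> R) : Prop :=
  forall (T T0 T0' S : osp d.+1) (p q : seq 'I_d.+1) (s s' : 'I_d.+1),
    osp_rank T = 1%N ->
    blocks T = [seq [set x]%SET | x <- p] ++
                 [set s; s']%SET :: [seq [set x]%SET | x <- q] ->
    blocks T0 = [seq [set x]%SET | x <- p] ++
                  [:: [set s]; [set s']]%SET ++ [seq [set x]%SET | x <- q] ->
    blocks T0' = [seq [set x]%SET | x <- p] ++
                   [:: [set s']; [set s]]%SET ++ [seq [set x]%SET | x <- q] ->
    blocks S = [seq B <- [:: [set x in p]; [set s; s']; [set x in q]]%SET
                  | B != finset.set0] ->
    2 * bext b T + bext b S <=
      bext b T0 + bext b T0' + (if p is [::] then 0 else bext b (osp_top d)).

End Polyhedra.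

Arguments nested_braid_fan R d : clear implicits.

(* Main.v *)
(* For a permutation pi, the ordered partitions above T(pi) are the cut sets
   A of 'I_d (cut after each position of A), joins and meets being intersections
   and unions, and the gaps of e_A are the indicator of A.  On the maximal cone
   of (pi, tau) let u(pi, tau) be the point of V_d whose pairing with every ray
   e_T of that cone is b_T.  Since the maximal cones are exactly the normal cones
   of the vertices of P0, b is deforming iff <e_T, u(pi, tau)> <= b_T for all pi,
   tau and T.  Choosing tau so that the relevant rays lie in one cone, this gives
   both families of inequalities.

   Conversely, submodularity makes the greedy algorithm work inside the braid cone
   of pi: <e_T, u(pi, tau)> <= b_T for T above T(pi), and for any y the value
   <y, u(pi, tau)> does not decrease when tau is replaced by a permutation
   sorting the gaps of y.  If the smallest gap of y is negative, exchanging the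
   two positions around it does not decrease the value either, by the essential
   inequality and the greedy bound.  Each exchange increases
   sum_k k * y(pi^-1 k), so sorting e_T this way ends in a braid cone containing
   it. *)

Require Import Defs.
From mathcomp Require Import all_boot all_order all_fingroup all_algebra.
From mathcomp Require Import classical_sets reals.
From mathcomp Require Import fintype finset zify ring lra.

Set Implicit Arguments.
Unset Strict Implicit.
Unset Printing Implicit Defensive.

Import Order.TTheory GRing.Theory Num.Theory.
Local Open Scope ring_scope.

(** * Ordered set partitions as level functions *)

Section Level.
Variable n : nat.
Implicit Types (S T : osp n) (x y : 'I_n).

(** Partitions are handled through these block indices, counted from 0: they determine the partition
    ([lv_inj]) and describe refinement ([osp_leP]), so lists of sets can mostly be avoided. *)
Definition lv T x : nat := find (fun B : {set 'I_n} => x \in B) (blocks T).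

Lemma lv_lt T x : (lv T x < size (blocks T))%N.
Proof.
rewrite /lv -has_find.
case/and3P: (ospP T) => _ _ /eqP/setP/(_ x); rewrite inE bigcup_seq.
by case/bigcupP => B BT xB; apply/hasP; exists B.
Qed.

Lemma mem_nth_lv T x j : (j < size (blocks T))%N ->
  (x \in nth set0 (blocks T) j) = (lv T x == j).
Proof.
move=> jT; have lT := lv_lt T x.
have xl : x \in nth set0 (blocks T) (lv T x).
  by apply: (nth_find set0 (a := fun B : {set 'I_n} => x \in B)); rewrite has_find.
apply/idP/eqP => [xj|<- //].
case/and3P: (ospP T) => _ /(pairwiseP set0) pw _.
have dis i k : (i < k)%N -> (k < size (blocks T))%N ->
    x \in nth set0 (blocks T) i -> x \in nth set0 (blocks T) k -> False.
  move=> ik kT xi xk; have := pw i k (ltn_trans ik kT) kT ik.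
  by move=> /pred0P/(_ x) /=; rewrite xi xk.
case: (ltngtP (lv T x) j) => // h; [exact: False_ind (dis _ _ h jT xl xj)|].
exact: False_ind (dis _ _ h lT xj xl).
Qed.

Lemma lv_onto T j : (j < size (blocks T))%N -> exists x, lv T x = j.
Proof.
move=> jT; have : nth set0 (blocks T) j != set0.
  apply: contraTneq (mem_nth set0 jT) => ->.
  by case/and3P: (ospP T).
by case/set0Pn => x; rewrite mem_nth_lv // => /eqP; exists x.
Qed.

(** Every block is nonempty, so the levels attained are exactly the indices below the number of
    blocks; equal levels force equal lengths and then equal blocks. *)
Lemma lv_inj S T : lv S =1 lv T -> S = T.
Proof.
have le A B : lv A =1 lv B -> (size (blocks B) <= size (blocks A))%N.
  move=> e; rewrite leqNgt; apply/negP => /lv_onto[x xA].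
  by have := lv_lt A x; rewrite e xA ltnn.
move=> e; apply: val_inj; apply: (@eq_from_nth _ set0) => [|i iS].
  by apply/eqP; rewrite eqn_leq !le.
apply/setP => x; rewrite !mem_nth_lv ?e //.
by apply: leq_trans iS _; apply: le => z; rewrite e.
Qed.

Lemma filter_ltS (f : nat -> nat) m s : sorted leq (map f s) ->
  [seq k <- s | f k < m.+1]%N =
  [seq k <- s | f k < m]%N ++ [seq k <- s | f k == m].
Proof.
elim: s => //= x s IH srt; have := IH (path_sorted srt) => ->.
have /allP mn := order_path_min leq_trans srt.
rewrite ltnS leq_eqVlt; case: (ltngtP (f x) m) => //= fx.
rewrite (eq_in_filter (a2 := pred0)) ?filter_pred0 // => k ks /=.
by apply/negbTE; rewrite -leqNgt -fx mn // map_f.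
Qed.

(** Monotonicity makes each fiber of [f] a run of consecutive entries. This is how the grouping
    demanded by [osp_le] is rebuilt from level functions. *)
Lemma flatten_fibers (f : nat -> nat) m s : sorted leq (map f s) ->
  flatten [seq [seq k <- s | f k == j] | j <- iota 0 m] =
  [seq k <- s | f k < m]%N.
Proof.
move=> srt; elim: m => [|m IH]; first by rewrite (eq_filter (a2 := pred0)) ?filter_pred0.
by rewrite -addn1 iotaD map_cat flatten_cat IH /= cats0 addn1 filter_ltS.
Qed.

Lemma reshape_index_mono ss i j : (i <= j)%N ->
  (reshape_index ss i <= reshape_index ss j)%N.
Proof. by rewrite (reshape_leq ss) => /orP[/ltnW|/andP[/eqP->]]. Qed.

Lemma osp_leP S T :
  osp_le S T <-> forall x y, (lv S x <= lv S y)%N -> (lv T x <= lv T y)%N.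
Proof.
split=> [[ss [eS eT]] x y le_xy|mono].
- have sS : sumn (shape ss) = size (blocks S) by rewrite -size_flatten eS.
  (* The block of [T] containing [z] is the run of [ss] into which the [S]-block of [z] falls. *)
  have lvT z : lv T z = reshape_index (shape ss) (lv S z).
    have zS := lv_lt S z; rewrite -sS in zS.
    have rT : (reshape_index (shape ss) (lv S z) < size (blocks T))%N.
      by rewrite -eT size_map; have := reshape_indexP zS; rewrite size_map.
    apply/eqP; rewrite -mem_nth_lv // -eT (nth_map [::]); last first.
      by move: rT; rewrite -eT size_map.
    rewrite bigcup_seq; apply/bigcupP.
    exists (nth set0 (blocks S) (lv S z)); last by rewrite mem_nth_lv // lv_lt.
    rewrite -eS nth_flatten; apply: mem_nth.
    have := reshape_offsetP zS; rewrite (nth_map [::]) //.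
    by move: rT; rewrite -eT size_map.
  by rewrite !lvT; apply: reshape_index_mono.
(* [f] sends an [S]-level to the [T]-level of any element there; monotonicity makes the choice
   irrelevant, and the default 0 only concerns levels that do not occur. The runs are the fibers of
   [f]. *)
- pose f k := odflt 0%N (omap (lv T) [pick x | lv S x == k]).
  have fE x : f (lv S x) = lv T x.
    rewrite /f; case: pickP => [y /eqP yx|/(_ x)] /=; last by rewrite eqxx.
    by apply/eqP; rewrite eqn_leq !mono ?yx.
  pose I := iota 0 (size (blocks S)).
  have srt : sorted leq (map f I).
    apply: (homo_sorted_in (P := mem I) (e := leq)) (iota_sorted _ _);
      last exact: allss.
    move=> i j.
    rewrite /= !mem_iota !add0n.
    by move=> /lv_onto[x <-] /lv_onto[y <-]; rewrite !fE; apply: mono.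
  exists [seq [seq nth set0 (blocks S) k | k <- I & f k == j]
            | j <- iota 0 (size (blocks T))]; split.
    have := flatten_fibers (size (blocks T)) srt.
    move=> /(congr1 (map (nth set0 (blocks S)))); rewrite map_flatten -map_comp.
    move=> ->; rewrite (eq_in_filter (a2 := predT)) ?filter_predT.
      exact: mkseq_nth.
    move=> k; rewrite mem_iota add0n => /lv_onto[x <-].
    by rewrite fE lv_lt.
  apply: (@eq_from_nth _ set0); first by rewrite !size_map size_iota.
  move=> j; rewrite !size_map size_iota => jT.
  rewrite -map_comp (nth_map 0%N) ?size_iota //= nth_iota // add0n.
  apply/setP => x; rewrite mem_nth_lv // bigcup_seq.
  apply/bigcupP/eqP => [[B /mapP[k]]|<-].
    rewrite mem_filter mem_iota add0n => /andP[/eqP <- kS] ->.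
    by rewrite mem_nth_lv // => /eqP <-.
  exists (nth set0 (blocks S) (lv S x)); last by rewrite mem_nth_lv ?lv_lt.
  by apply: map_f; rewrite mem_filter mem_iota lv_lt fE eqxx.
Qed.

End Level.

Lemma osp_vecE (R : realType) (d : nat) (T : osp d.+1) (x : 'I_d.+1) :
  osp_vec R T 0 x = (lv T x).+1%:R.
Proof.
rewrite /osp_vec summxE (bigD1 (Ordinal (lv_lt T x))) //= [X in _ + X]big1 => [|i ne].
  rewrite addr0 mxE summxE (bigD1 x) ?mem_nth_lv ?lv_lt //=.
  rewrite mxE !eqxx big1 ?addr0 ?mulr1 // => j /andP[_ ne].
  by rewrite mxE eqxx eq_sym (negbTE ne).
rewrite mxE summxE big1 ?mulr0 // => j; rewrite mem_nth_lv // => /eqP lj.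
rewrite mxE eqxx /=; case: eqP => // xj; case/eqP: ne; apply: val_inj => /=.
by rewrite xj lj.
Qed.

(** * The interval above a permutation as the Boolean lattice of cut sets *)

Section Cuts.
Variable d : nat.
Implicit Types (A B C : {set 'I_d}) (pi : 'S_d.+1) (S T U : osp d.+1).

(* The index of the block containing position [k] when cuts are made after the
   positions in [A]. *)
Definition level A (k : nat) : nat := #|[set a in A | (a < k)%N]|.

Lemma level0 A : level A 0 = 0%N.
Proof. by apply: eq_card0 => a; rewrite inE andbF. Qed.

Lemma levelS A (k : 'I_d) : level A k.+1 = (level A k + (k \in A))%N.
Proof.
rewrite /level (cardsD1 k) inE ltnSn andbT addnC; congr (_ + _)%N.
apply: eq_card => a; rewrite !inE ltnS leq_eqVlt -val_eqE /=.
by case: ltngtP; rewrite ?andbF ?andbT.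
Qed.

Lemma levelD A : level A d = #|A|.
Proof. by apply: eq_card => a; rewrite !inE ltn_ord andbT. Qed.

Lemma level_mono A : {homo level A : i j / (i <= j)%N}.
Proof.
move=> i j ij; apply: subset_leq_card; apply/subsetP => a; rewrite !inE.
by case/andP => -> /= ai; apply: leq_trans ij.
Qed.

(** A discrete intermediate value property: the level starts at 0 and rises by at most one at each
    position. It shows that the blocks of a cut are nonempty. *)
Lemma level_onto A k l : (k <= d)%N -> (l <= level A k)%N ->
  exists2 j, (j <= k)%N & level A j = l.
Proof.
elim: k => [|k IH] kd; first by rewrite level0 leqn0 => /eqP->; exists 0%N; rewrite ?level0.
rewrite leq_eqVlt => /orP[/eqP->|]; first by exists k.+1.
rewrite (levelS A (Ordinal kd)) /= => h.
have /IH[|j jk <-]: (l <= level A k)%N by case: (_ \in _) h; lia.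
  exact: ltnW.
by exists j => //; apply: leq_trans jk _.
Qed.

Lemma levelUI A B k :
  (level (A :&: B) k + level (A :|: B) k = level A k + level B k)%N.
Proof.
rewrite /level addnC -[RHS]cardsUI.
have -> : [set a in A :|: B | (a < k)%N] =
          [set a in A | (a < k)%N] :|: [set a in B | (a < k)%N].
  by apply/setP => a; rewrite !inE andb_orl.
suff -> : [set a in A :&: B | (a < k)%N] =
          [set a in A | (a < k)%N] :&: [set a in B | (a < k)%N] by [].
apply/setP => a; rewrite !inE.
by case: (a < k)%N; rewrite ?andbT ?andbF.
Qed.

Lemma cut_blocks_osp pi A :
  is_osp (mkseq (fun l => [set x | level A (pi x) == l]) #|A|.+1).
Proof.
apply/and3P; split.
- apply/negP => /mapP[l]; rewrite mem_iota ltnS => /= lA /setP e.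
  rewrite -levelD in lA.
  have [j jd jl] := level_onto (leqnn d) lA.
  have := e ((pi^-1)%g (Ordinal (jd : (j < d.+1)%N))).
  by rewrite !inE permKV /= jl eqxx.
- rewrite pairwise_map; have := iota_uniq 0 #|A|.+1; rewrite uniq_pairwise.
  apply: sub_pairwise => i j /eqP ij; apply/pred0P => x /=.
  by rewrite !inE; apply/negP => /andP[/eqP-> /eqP].
- apply/eqP/setP => x; rewrite [RHS]inE bigcup_seq; apply/bigcupP.
  exists [set y | level A (pi y) == level A (pi x)]; last by rewrite inE.
  apply: map_f; rewrite mem_iota /= ltnS -levelD level_mono //.
  by rewrite -ltnS.
Qed.

Definition cut pi A : osp d.+1 := Osp (cut_blocks_osp pi A).

Lemma lv_cut pi A x : lv (cut pi A) x = level A (pi x).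
Proof.
have lx : (level A (pi x) < size (blocks (cut pi A)))%N.
  by rewrite size_mkseq ltnS -levelD level_mono // -ltnS.
apply/eqP; rewrite -mem_nth_lv //= nth_mkseq ?inE //.
by move: lx; rewrite size_mkseq.
Qed.

Lemma lv_osp_of_perm pi x : lv (osp_of_perm pi) x = pi x.
Proof.
apply/eqP; have lx : (pi x < size (blocks (osp_of_perm pi)))%N.
  by rewrite size_map size_enum_ord.
rewrite -mem_nth_lv //= (nth_map ord0) ?size_enum_ord // nth_ord_enum.
by rewrite inE permK.
Qed.

Lemma lv_top x : lv (osp_top d) x = 0%N.
Proof. by have := lv_lt (osp_top d) x; rewrite ltnS leqn0 => /eqP. Qed.

Lemma cut0 pi : cut pi set0 = osp_top d.
Proof.
apply: lv_inj => x; rewrite lv_cut lv_top; apply: eq_card0 => a.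
by rewrite !inE.
Qed.

Lemma osp_eq_cut pi A T :
  lv T ((pi^-1)%g ord0) = 0%N ->
  (forall i : 'I_d, lv T ((pi^-1)%g (lift ord0 i)) =
    (lv T ((pi^-1)%g (widen_ord (leqnSn d) i)) + (i \in A))%N) ->
  T = cut pi A.
Proof.
move=> T0 TS; apply: lv_inj => x; rewrite lv_cut.
suff main k : (k <= d)%N -> lv T ((pi^-1)%g (inord k)) = level A k.
  by rewrite -main ?inord_val ?permK // -ltnS.
elim: k => [_|k IH kd].
  by rewrite level0 -[RHS]T0 (_ : inord 0 = ord0) //; apply: val_inj; rewrite /= inordK.
have wk : widen_ord (leqnSn d) (Ordinal kd) = inord k.
  by apply: val_inj; rewrite /= inordK // ltnS ltnW.
have <- : lift ord0 (Ordinal kd) = inord k.+1 by apply: val_inj; rewrite /= inordK.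
by rewrite TS wk (IH (ltnW kd)) (levelS A (Ordinal kd)).
Qed.

(** The cuts are placed where the level strictly increases along [pi]. Since no block is empty, each
    increase is by exactly one, so these cuts recover [T]. *)
Lemma monotone_cut pi T :
  (forall i j : 'I_d.+1, (i <= j)%N ->
     (lv T ((pi^-1)%g i) <= lv T ((pi^-1)%g j))%N) ->
  exists A, T = cut pi A.
Proof.
move=> mono; pose l i := lv T ((pi^-1)%g i).
exists [set i | l (widen_ord (leqnSn d) i) < l (lift ord0 i)]%N.
apply: osp_eq_cut => [|i].
  have [|x x0] := @lv_onto _ T 0; first exact: leq_ltn_trans (lv_lt T ord0).
  by apply/eqP; rewrite -leqn0 -x0 -[x in X in (_ <= X)%N](permK pi) mono.
rewrite inE -!/(l _).
have le : (l (widen_ord (leqnSn d) i) <= l (lift ord0 i))%N by apply: mono => /=.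
case: ltnP => [lt|ge]; last by apply/eqP; rewrite eqn_leq addn0 ge le.
apply/eqP; rewrite addn1 eqn_leq lt andbT leqNgt; apply/negP => lt2.
(* A jump by two or more would skip a level, yet some [x] has that level; monotonicity rules out
   both positions up to [i] and positions after [i]. *)
have [|x xl] := @lv_onto _ T (l (widen_ord (leqnSn d) i)).+1.
  exact: ltn_trans lt2 (lv_lt _ _).
have [xi|ix] := leqP (pi x) i.
  have := mono (pi x) (widen_ord (leqnSn d) i) xi.
  by rewrite permK xl ltnn.
have := mono (lift ord0 i) (pi x); rewrite permK xl => /(_ ix).
by rewrite leqNgt lt2.
Qed.

Lemma in_intervalP pi T : in_interval pi T <-> exists A, T = cut pi A.
Proof.
split=> [[/osp_leP le _]|[A ->]].
  by apply: monotone_cut => i j ij; apply: le; rewrite !lv_osp_of_perm !permKV.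
split; apply/osp_leP => x y; last by rewrite !lv_top.
by rewrite !lv_osp_of_perm !lv_cut; apply: level_mono.
Qed.

(** Merging blocks removes cuts, so the order is reversed: joins become intersections and meets
    become unions. *)
Lemma le_cut pi A B : osp_le (cut pi A) (cut pi B) <-> B \subset A.
Proof.
split=> [/osp_leP le|BA].
  apply/subsetP => b bB; apply/negPn/negP => bA.
  have := le ((pi^-1)%g (lift ord0 b)) ((pi^-1)%g (widen_ord (leqnSn d) b)).
  rewrite !lv_cut !permKV /= !levelS (negbTE bA) bB addn0 leqnn.
  by move=> /(_ isT); rewrite addn1 ltnn.
apply/osp_leP => x y; rewrite !lv_cut.
have [xy _|yx] := leqP (pi x) (pi y); first exact: level_mono.
(* For [B] inside [A], the difference of the levels of [A] and [B] is nondecreasing in the position;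
   hence [B] has no cut wherever the level of [A] does not rise. *)
have : forall k, (pi y + k <= d)%N ->
    (level B (pi y + k) + level A (pi y) <=
     level A (pi y + k) + level B (pi y))%N.
  elim=> [|k IH] kd; first by rewrite addn0 addnC.
  rewrite addnS in kd *; have := IH (ltnW kd).
  rewrite !(levelS _ (Ordinal kd)) /=.
  have := subsetP BA (Ordinal kd).
  by case: (Ordinal kd \in B) => [/(_ isT)->|_]; rewrite /=; lia.
move/(_ (pi x - pi y)%N); rewrite subnKC; last exact: ltnW.
rewrite -ltnS ltn_ord => /(_ isT); lia.
Qed.

Lemma is_join_cut pi A B : is_join pi (cut pi A) (cut pi B) (cut pi (A :&: B)).
Proof.
split; rewrite ?le_cut ?subsetIl ?subsetIr //.
  by apply/in_intervalP; exists (A :&: B).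
by move=> U /in_intervalP[C ->]; rewrite !le_cut subsetI => -> ->.
Qed.

Lemma is_meet_cut pi A B : is_meet pi (cut pi A) (cut pi B) (cut pi (A :|: B)).
Proof.
split; rewrite ?le_cut ?subsetUl ?subsetUr //.
  by apply/in_intervalP; exists (A :|: B).
by move=> U /in_intervalP[C ->]; rewrite !le_cut subUset => -> ->.
Qed.

Lemma is_join_uniq pi S T U V :
  is_join pi S T U -> is_join pi S T V -> U = V.
Proof.
move=> [/[dup] iU /in_intervalP[A ->] SA TA mA].
move=> [/[dup] iV /in_intervalP[B ->] SB TB mB].
have /le_cut BA := mA _ (proj2 (in_intervalP _ _) (ex_intro _ B erefl)) SB TB.
have /le_cut AB := mB _ (proj2 (in_intervalP _ _) (ex_intro _ A erefl)) SA TA.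
by congr cut; apply/eqP; rewrite eqEsubset AB BA.
Qed.

Lemma is_meet_uniq pi S T U V :
  is_meet pi S T U -> is_meet pi S T V -> U = V.
Proof.
move=> [/[dup] iU /in_intervalP[A ->] SA TA mA].
move=> [/[dup] iV /in_intervalP[B ->] SB TB mB].
have /le_cut BA := mA _ (proj2 (in_intervalP _ _) (ex_intro _ B erefl)) SB TB.
have /le_cut AB := mB _ (proj2 (in_intervalP _ _) (ex_intro _ A erefl)) SA TA.
by congr cut; apply/eqP; rewrite eqEsubset AB BA.
Qed.

End Cuts.

Lemma local_submodularityP (R : realType) d (b : osp_bar d -> R) :
  local_submodularity b <-> forall pi A B,
    bext b (cut pi (A :&: B)) + bext b (cut pi (A :|: B)) <=
    bext b (cut pi A) + bext b (cut pi B).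
Proof.
split=> [sub pi A B|sub pi S T J M /in_intervalP[A ->] /in_intervalP[B ->] jJ mM].
  apply: (sub pi); try by apply/in_intervalP; eexists.
    exact: is_join_cut.
  exact: is_meet_cut.
by rewrite (is_join_uniq jJ (is_join_cut _ _ _)) (is_meet_uniq mM (is_meet_cut _ _ _)).
Qed.

(** * Sorting permutations and summation by parts *)

Section Sorting.
Variable R : realType.

Lemma exists_sorting n (g : 'I_n -> R) :
  exists s : 'S_n, forall i j : 'I_n, (i <= j)%N ->
    g ((s^-1)%g i) <= g ((s^-1)%g j).
Proof.
pose r i j := g i <= g j.
pose t := [tuple of sort r (ord_tuple n)].
have /tuple_permP[p tE] : perm_eq t (ord_tuple n) by rewrite perm_sort.
have tp i : tnth t i = p i.
  by rewrite (tnth_nth i) tE -tnth_nth tnth_mktuple tnth_ord_tuple.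
exists (p^-1)%g => i j ij; rewrite invgK -!tp !(tnth_nth i).
apply: (@sorted_leq_nth _ r) => //; rewrite ?inE ?size_tuple //.
- by move=> y x z; apply: le_trans.
- by move=> x; apply: lexx.
- by apply: sort_sorted => x y; apply: le_total.
Qed.

(** Summation by parts turns the sum into increments of [g] weighted by [D], plus a boundary term.
    The bound [c] is free so that the induction can take it to be the last value of [g]. *)
Lemma abel_sum_ge n (g : 'I_n -> R) (D : nat -> R) c :
  (forall i j : 'I_n, (i <= j)%N -> g i <= g j) -> (forall i, g i <= c) ->
  (forall k, 0 <= D k) -> D 0%N = 0 ->
  - (c * D n) <= \sum_(k < n) g k * (D k - D k.+1).
Proof.
move=> + + D_ge0 D0; elim: n g c => [|n IH] g c g_mono g_c.
  by rewrite big_ord0 D0 mulr0 oppr0.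
rewrite big_ord_recr /=.
have := IH (fun i => g (widen_ord (leqnSn n) i)) (g ord_max).
move=> /(_ (fun i j => g_mono (widen_ord _ i) (widen_ord _ j))).
move=> /(_ (fun i => g_mono (widen_ord _ i) ord_max (ltnW (ltn_ord i)))) h.
apply: le_trans (lerD h (lexx _)).
have := ler_wpM2r (D_ge0 n.+1) (g_c ord_max); lra.
Qed.

End Sorting.

(** * Linear extensions of [b] from the maximal cones, and the greedy bound *)

Section Functionals.
Variables (R : realType) (d : nat).
Local Notation vec := 'rV[R]_d.+1.
Implicit Types (A B C : {set 'I_d}) (pi : 'S_d.+1) (tau : 'S_d).
Implicit Types (T : osp d.+1) (y z : vec) (b : osp_bar d -> R).

Local Notation pos0 pi := ((pi^-1)%g ord0).
Local Notation e pi A := (osp_vec R (cut pi A)).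

(** These are the upper sets of the order given by [tau]. For k < d their cuts give the rays of the
    maximal cone of [pi] and [tau]; k = d gives the top partition, whose vector is zero in W_d. *)
Definition chain tau (k : nat) : {set 'I_d} := [set a | (k <= tau a)%N].

Lemma chain0 tau : chain tau 0 = setT.
Proof. by apply/setP => a; rewrite !inE. Qed.

Lemma chaind tau : chain tau d = set0.
Proof. by apply/setP => a; rewrite !inE leqNgt ltn_ord. Qed.

Lemma level_chain tau (k : 'I_d) m :
  level (chain tau k) m = (level (chain tau k.+1) m + ((tau^-1)%g k < m))%N.
Proof.
rewrite /level; set a := (tau^-1)%g k.
rewrite (cardsD1 a) !inE permKV leqnn /= addnC; congr (_ + _)%N.
apply: eq_card => c; rewrite !inE [in RHS]ltn_neqAle.
have -> : (nat_of_ord k == tau c) = (c == a).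
  by rewrite (inj_eq val_inj) -(inj_eq (@perm_inj _ tau) c) permKV eq_sym.
by rewrite andbA.
Qed.

Lemma gap_osp_vec pi T i : gap pi (osp_vec R T) i =
  (lv T ((pi^-1)%g (lift ord0 i)))%:R -
  (lv T ((pi^-1)%g (widen_ord (leqnSn d) i)))%:R.
Proof. by rewrite /gap !osp_vecE -!(addn1 (lv _ _)) !natrD; ring. Qed.

Lemma gap_cut pi A i : gap pi (e pi A) i = (i \in A)%:R.
Proof. by rewrite gap_osp_vec !lv_cut !permKV /= levelS natrD; ring. Qed.

Lemma coord_gap pi y x :
  y 0 x = y 0 (pos0 pi) + \sum_(i < d) gap pi y i * (i < pi x)%:R.
Proof.
suff main k : (k <= d)%N -> y 0 ((pi^-1)%g (inord k)) =
    y 0 (pos0 pi) + \sum_(i < d) gap pi y i * (i < k)%:R.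
  by rewrite -main ?inord_val ?permK // -ltnS.
elim: k => [_|k IH kd].
  rewrite big1 ?addr0 => [|i _]; last by rewrite mulr0.
  by rewrite (_ : inord 0 = ord0) //; apply: val_inj; rewrite /= inordK.
have := IH (ltnW kd); set w := widen_ord (leqnSn d) (Ordinal kd).
have -> : inord k = w by apply: val_inj; rewrite /= inordK // ltnS ltnW.
have -> : inord k.+1 = lift ord0 (Ordinal kd) by apply: val_inj; rewrite /= inordK.
move=> h; rewrite [in RHS](bigD1 (Ordinal kd)) //= ltnSn mulr1 [in RHS]/gap -/w h.
rewrite (bigD1 (Ordinal kd)) //= ltnn mulr0 add0r.
set s1 := \sum_(i < d | _) _; set s2 := \sum_(i < d | _) _.
suff -> : s2 = s1 by ring.
apply: eq_bigr => i ne; congr (_ * (nat_of_bool _)%:R).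
by rewrite ltnS leq_eqVlt -[k]/(nat_of_ord (Ordinal kd)) (inj_eq val_inj) (negbTE ne).
Qed.

Lemma pairing_osp_vec T z : Vd z ->
  pairing (osp_vec R T) z = \sum_x (lv T x)%:R * z 0 x.
Proof.
rewrite /Vd /= => z0; rewrite -[RHS]addr0 -[X in _ + X]z0 -big_split.
by apply: eq_bigr => x _ /=; rewrite osp_vecE -addn1 natrD mulrDl mul1r.
Qed.

(** By [level_chain], consecutive chain vectors differ by the indicator of the positions after one
    gap. Any [y] is a constant vector plus the combination of these indicators weighted by its gaps,
    and the constant pairs to zero with V_d. *)
Lemma pairing_gap pi tau y z : Vd z -> pairing y z =
  \sum_(k < d) gap pi y ((tau^-1)%g k) *
    (pairing (e pi (chain tau k)) z - pairing (e pi (chain tau k.+1)) z).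
Proof.
move=> z0; have c0 : \sum_x y 0 (pos0 pi) * z 0 x = 0.
  by rewrite -mulr_sumr [X in _ * X]z0 mulr0.
transitivity (\sum_x \sum_(k < d)
    gap pi y ((tau^-1)%g k) * (((tau^-1)%g k < pi x)%:R * z 0 x)).
  rewrite /pairing -[RHS]add0r -[X in X + _]c0 -big_split.
  apply: eq_bigr => x _ /=; rewrite (coord_gap pi y x) mulrDl; congr (_ + _).
  rewrite (reindex_inj (@perm_inj _ (tau^-1)%g)) mulr_suml.
  by apply: eq_bigr => k _; rewrite mulrA.
rewrite exchange_big; apply: eq_bigr => k _ /=; rewrite -mulr_sumr; congr (_ * _).
rewrite !pairing_osp_vec // -sumrB; apply: eq_bigr => x _.
rewrite !lv_cut level_chain natrD; ring.
Qed.

(* The value at [y] of the linear function that agrees with [b] on the rays of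
   the maximal cone of [pi] and [tau]. *)
Definition cone_extension b pi tau y : R :=
  \sum_(k < d) gap pi y ((tau^-1)%g k) *
    (bext b (cut pi (chain tau k)) - bext b (cut pi (chain tau k.+1))).

(** This is the point u(pi, tau): its coordinates are the values of the linear function on the
    standard basis. *)
Definition cone_point b pi tau : vec :=
  \row_x cone_extension b pi tau (delta_mx 0 x).

Lemma pairing_cone_point b pi tau y :
  pairing y (cone_point b pi tau) = cone_extension b pi tau y.
Proof.
rewrite /pairing; under eq_bigr do rewrite mxE mulr_sumr.
rewrite exchange_big; apply: eq_bigr => k _ /=.
under eq_bigr do rewrite mulrA.
rewrite -mulr_suml; congr (_ * _).
rewrite /gap; set p := (pi^-1)%g _; set q := (pi^-1)%g _.
have coord x : \sum_i y 0 i * (delta_mx 0 i : vec) 0 x = y 0 x.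
  rewrite {2}(row_sum_delta y) summxE; apply: eq_bigr => i _.
  by rewrite [in RHS]mxE.
by under eq_bigr do rewrite mulrBr; rewrite sumrB !coord.
Qed.

Lemma cone_point_Vd b pi tau : Vd (cone_point b pi tau).
Proof.
have := pairing_cone_point b pi tau (const_mx 1).
rewrite /pairing; under eq_bigr do rewrite mxE mul1r.
move=> h; rewrite /Vd /= h /cone_extension big1 // => k _.
by rewrite /gap !mxE subrr mul0r.
Qed.

(** The extension is a pairing with a point of V_d, so [pairing_gap] expands it along the chain of
    any other maximal cone. All comparisons between cones start from this formula. *)
Lemma cone_extension_gap b pi tau pi' tau' y :
  cone_extension b pi' tau' y = \sum_(k < d) gap pi y ((tau^-1)%g k) *
    (cone_extension b pi' tau' (e pi (chain tau k)) -
     cone_extension b pi' tau' (e pi (chain tau k.+1))).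
Proof.
rewrite -pairing_cone_point (pairing_gap pi tau) //; last exact: cone_point_Vd.
by apply: eq_bigr => k _; rewrite !pairing_cone_point.
Qed.

Lemma sorted_osp_cut pi T :
  (forall i j : 'I_d.+1, (i <= j)%N ->
     osp_vec R T 0 ((pi^-1)%g i) <= osp_vec R T 0 ((pi^-1)%g j)) ->
  exists A, T = cut pi A.
Proof.
move=> srt; apply: monotone_cut => i j ij.
by have := srt _ _ ij; rewrite !osp_vecE ler_nat.
Qed.

Lemma braid_cut pi A (i j : 'I_d.+1) : (i <= j)%N ->
  e pi A 0 ((pi^-1)%g i) <= e pi A 0 ((pi^-1)%g j).
Proof.
by move=> ij; rewrite !osp_vecE ler_nat !lv_cut !permKV ltnS level_mono.
Qed.

Lemma nested_cone_cut pi tau A :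
  (forall i j : 'I_d, (i <= j)%N ->
     (tau^-1)%g i \in A -> (tau^-1)%g j \in A) ->
  nested_braid_cone pi tau (e pi A).
Proof.
move=> up; split=> [|i j ij]; first exact: braid_cut.
rewrite !gap_cut ler_nat; case: (boolP (_ i \in A)) => // /(up _ _ ij) -> //.
Qed.

Lemma nested_cone_chain pi tau k :
  nested_braid_cone pi tau (e pi (chain tau k)).
Proof.
by apply: nested_cone_cut => i j ij; rewrite !inE !permKV => /leq_trans; apply.
Qed.

Lemma cone_extension_cut b pi tau A : cone_extension b pi tau (e pi A) =
  \sum_(k < d) ((tau^-1)%g k \in A)%:R *
    (bext b (cut pi (chain tau k)) - bext b (cut pi (chain tau k.+1))).
Proof. by apply: eq_bigr => k _; rewrite gap_cut. Qed.

Lemma bext_top b : bext b (osp_top d) = 0.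
Proof. by rewrite /bext insubF // eqxx. Qed.

(** The sum starts at [A] and ends at the empty cut set, that is at the top, where [b] is extended
    by 0. *)
Lemma bext_telescope b pi tau A :
  bext b (cut pi A) = \sum_(k < d)
    (bext b (cut pi (A :&: chain tau k)) -
     bext b (cut pi (A :&: chain tau k.+1))).
Proof.
rewrite -(big_mkord xpredT (fun k => bext b (cut pi (A :&: chain tau k)) -
            bext b (cut pi (A :&: chain tau k.+1)))).
under eq_bigr do rewrite -opprB.
rewrite sumrN telescope_sumr // chain0 chaind setI0 setIT cut0 bext_top sub0r.
by rewrite opprK.
Qed.

(** A ray of the cone has a cut set [A] closed upwards for [tau]. Term by term against
    [bext_telescope]: if the k-th position is in [A], then [A] contains the whole chain from there
    on; otherwise intersecting with [A] gives no increment. *)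
Lemma cone_extension_ray b pi tau T :
  nested_braid_cone pi tau (osp_vec R T) ->
  cone_extension b pi tau (osp_vec R T) = bext b T.
Proof.
case=> /sorted_osp_cut[A ->] srt.
rewrite cone_extension_cut (bext_telescope _ _ tau); apply: eq_bigr => k _.
have up (i j : 'I_d) : (i <= j)%N -> (tau^-1)%g i \in A -> (tau^-1)%g j \in A.
  by move=> /srt; rewrite !gap_cut ler_nat => + iA; rewrite iA lt0b.
case: (boolP (_ \in A)) => kA; [rewrite mul1r|rewrite mul0r].
  have sub m : (k <= m)%N -> A :&: chain tau m = chain tau m.
    move=> km; apply/setIidPr/subsetP => a; rewrite inE => ma.
    by have := up _ (tau a) (leq_trans km ma) kA; rewrite permK.
  by rewrite !sub.
suff -> : A :&: chain tau k = A :&: chain tau k.+1 by rewrite subrr.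
apply/setP => a; rewrite !inE; case: (boolP (a \in A)) => //= aA.
rewrite leq_eqVlt; case: eqP => //= ka.
by case/negP: kA; rewrite (val_inj ka) permK.
Qed.

(** The greedy argument: by submodularity, adding a position of [A] to a larger set increases [b] by
    no more than adding it to the trace of that set on [A]. Comparing with [bext_telescope] term by
    term gives the bound. *)
Lemma cone_extension_le b pi tau A : local_submodularity b ->
  cone_extension b pi tau (e pi A) <= bext b (cut pi A).
Proof.
move=> /local_submodularityP sub.
rewrite cone_extension_cut (bext_telescope _ _ tau); apply: ler_sum => k _.
have chainS : chain tau k = (tau^-1)%g k |: chain tau k.+1.
  apply/setP => a; rewrite !inE leq_eqVlt; congr (_ || _).
  by rewrite (inj_eq val_inj) -(inj_eq (@perm_inj _ tau) a) permKV eq_sym.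
case: (boolP (_ \in A)) => kA; [rewrite mul1r|rewrite mul0r].
  have := sub pi (A :&: chain tau k) (chain tau k.+1).
  have -> : A :&: chain tau k :&: chain tau k.+1 = A :&: chain tau k.+1.
    by rewrite chainS; apply/setP => a; rewrite !inE; case: leqP; rewrite ?orbT ?andbT ?andbF.
  have -> : A :&: chain tau k :|: chain tau k.+1 = chain tau k.
    rewrite chainS; apply/setP => a; rewrite !inE.
    by case: eqP => [->|]; rewrite ?kA //=; case: leqP; rewrite ?andbF ?orbT.
  lra.
suff -> : A :&: chain tau k = A :&: chain tau k.+1 by rewrite subrr.
rewrite chainS; apply/setP => a; rewrite !inE.
by case: eqP => [->|//]; rewrite (negbTE kA).
Qed.

(** Expanded along the chain of [tau'], the difference of the two values has the gaps of [y], now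
    sorted, as coefficients and the increments of the greedy slack [D] as terms. Summation by parts
    makes it nonnegative. *)
Lemma cone_extension_sorted_le b pi tau tau' y : local_submodularity b ->
  (forall i j : 'I_d, (i <= j)%N ->
     gap pi y ((tau'^-1)%g i) <= gap pi y ((tau'^-1)%g j)) ->
  cone_extension b pi tau y <= cone_extension b pi tau' y.
Proof.
move=> sub srt; rewrite (cone_extension_gap b pi tau') -subr_ge0 -sumrB.
pose D k := bext b (cut pi (chain tau' k)) -
            cone_extension b pi tau (e pi (chain tau' k)).
have D_ge0 k : 0 <= D k by rewrite subr_ge0 cone_extension_le.
(* The full and the empty cut set belong to every chain, so the slack vanishes at both ends. *)
have D0 : D 0%N = 0.
  by rewrite /D chain0 -(chain0 tau) cone_extension_ray ?subrr //;
     apply: nested_cone_chain.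
have Dd : D d = 0.
  by rewrite /D chaind -(chaind tau) cone_extension_ray ?subrr //;
     apply: nested_cone_chain.
(* Any upper bound for the gaps will do, since it gets multiplied by [D d], which is 0. *)
have gc i : gap pi y ((tau'^-1)%g i) <= \sum_j `|gap pi y j|.
  rewrite (bigD1 ((tau'^-1)%g i)) //= (le_trans (ler_norm _)) // lerDl.
  by apply: sumr_ge0.
have := abel_sum_ge srt gc D_ge0 D0; rewrite Dd mulr0 oppr0.
by congr (_ <= _); apply: eq_bigr => k _; rewrite /D; ring.
Qed.

End Functionals.

(** * Exchanging two adjacent positions *)

Section Swaps.
Variable d : nat.
Implicit Types (A : {set 'I_d}) (pi : 'S_d.+1) (i : 'I_d) (T : osp d.+1).

Definition swap pi i : 'S_d.+1 :=
  (pi * tperm (widen_ord (leqnSn d) i) (lift ord0 i))%g.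

Lemma swapE pi i x : swap pi i x = (if pi x == i :> nat then i.+1
  else if pi x == i.+1 :> nat then i : nat else pi x) :> nat.
Proof.
rewrite permM; case: tpermP => [->|->|/eqP ni /eqP ni1] /=.
- by rewrite eqxx.
- by rewrite /bump /= add1n eqxx gtn_eqF.
rewrite -val_eqE /= in ni; rewrite -val_eqE /= in ni1.
by rewrite (negbTE ni) -[i.+1]/(bump 0 i) (negbTE ni1).
Qed.

(** Without a cut at [i], the two exchanged positions lie in the same block. *)
Lemma cut_swap pi i A : i \notin A -> cut (swap pi i) A = cut pi A.
Proof.
move=> iA; apply: lv_inj => x; rewrite !lv_cut swapE.
by case: eqP => [->|_]; last case: eqP => [->|_] //;
  rewrite levelS (negbTE iA) addn0.
Qed.

(** The cut set of the partition S in the essential inequality: the block of positions i and i + 1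
    is cut off on either side, where a side exists. *)
Definition neighbours i : {set 'I_d} :=
  [set j : 'I_d | (j.+1 == i :> nat) || (j == i.+1 :> nat)].

Lemma notin_neighbours i : i \notin neighbours i.
Proof. by rewrite inE; apply/negP; lia. Qed.

Lemma level_eq A (F : nat -> nat) : F 0%N = 0%N ->
  (forall k : 'I_d, F k.+1 = F k + (k \in A))%N ->
  forall k, (k <= d)%N -> level A k = F k.
Proof.
move=> F0 FS; elim=> [|k IH] kd; first by rewrite level0.
by have := FS (Ordinal kd); rewrite (levelS A (Ordinal kd)) /= IH // ltnW.
Qed.

Lemma level_setT k : (k <= d)%N -> level [set: 'I_d] k = k.
Proof. by apply: (@level_eq setT id) => // j; rewrite inE addn1. Qed.

Lemma level_setC1 i k : (k <= d)%N -> level (~: [set i]) k = (k - (i < k))%N.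
Proof.
apply: (@level_eq _ (fun k => k - (i < k))%N) => // j.
by rewrite !inE -val_eqE /=; lia.
Qed.

Lemma level_neighbours i k : (k <= d)%N ->
  level (neighbours i) k = ((0 < i <= k) + (i.+1 < k))%N.
Proof.
apply: (@level_eq _ (fun k => (0 < i <= k) + (i.+1 < k))%N) => [|j].
  by rewrite leqn0 ltn0 addn0; case: (nat_of_ord i).
rewrite !inE; lia.
Qed.

(** The last term does not depend on [x], so it is a multiple of the all-ones vector. It compensates
    for S having no block before the pair when [i] is 0. *)
Lemma level_swap pi i x :
  (lv (cut pi setT) x + lv (cut (swap pi i) setT) x =
   2 * lv (cut pi (~: [set i])) x + lv (cut pi (neighbours i)) x + (i == 0 :> nat))%N.
Proof.
have pos (sg : 'S_d.+1) : (sg x <= d)%N by rewrite -ltnS.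
rewrite !lv_cut !level_setT // level_setC1 // level_neighbours // swapE.
by case: eqP => [?|?]; last case: eqP => [?|?]; lia.
Qed.

End Swaps.

(** * From explicit lists of blocks to cuts *)

Section OspOfSeqs.
Variable n : nat.

Lemma osp_of_seqs (ls : seq (seq 'I_n)) : [::] \notin ls ->
  uniq (flatten ls) -> (forall x, x \in flatten ls) ->
  is_osp [seq [set x in t] | t <- ls].
Proof.
move=> ls0 ls_uniq ls_all; apply/and3P; split.
- apply/negP => /mapP[[|a t] tls /setP]; first by rewrite tls in ls0.
  by move=> /(_ a); rewrite !inE eqxx.
- rewrite (pairwise_map (fun t : seq _ => [set x in t])); elim: ls ls_uniq {ls0 ls_all} => //= t ls IH.
  rewrite cat_uniq => /and3P[_ /hasPn dis /IH ->]; rewrite andbT.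
  apply/allP => t' t'ls; apply/pred0P => x; rewrite /= !inE.
  apply/negP => /andP[xt xt'].
  by have /negP := dis x (introT flattenP (ex_intro2 _ _ t' t'ls xt')); apply.
- apply/eqP/setP => x; rewrite [RHS]inE bigcup_seq; apply/bigcupP.
  have /flattenP[t tls xt] := ls_all x.
  by exists [set y in t]; rewrite ?inE //; apply: map_f.
Qed.

Lemma map_set1 (p : seq 'I_n) :
  [seq [set x] | x <- p] = [seq [set x in t] | t <- [seq [:: x] | x <- p]].
Proof.
by rewrite -map_comp; apply: eq_map => x /=; apply/setP => y; rewrite !inE.
Qed.

Lemma set2_seq (s s' : 'I_n) : [set s; s'] = [set x in [:: s; s']].
Proof. by apply/setP => y; rewrite !inE. Qed.

Lemma set_seq_eq0 (p : seq 'I_n) : ([set x in p] == set0) = (p == [::]).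
Proof.
case: p => [|a p]; first by apply: introT eqP _; apply/setP => x; rewrite !inE.
by apply: introF eqP _ => /setP/(_ a); rewrite !inE eqxx.
Qed.

Lemma filter_set_seq (ls : seq (seq 'I_n)) :
  [seq B <- [seq [set x in t] | t <- ls] | B != set0] =
  [seq [set x in t] | t <- [seq t <- ls | t != [::]]].
Proof.
by rewrite filter_map; congr map; apply: eq_filter => t /=; rewrite set_seq_eq0.
Qed.

Lemma lv_eq (T : osp n) x j :
  (j < size (blocks T))%N -> x \in nth set0 (blocks T) j -> lv T x = j.
Proof. by move=> jT; rewrite mem_nth_lv // => /eqP. Qed.

End OspOfSeqs.

Section WallsFromSeqs.
Variables (d : nat) (pi : 'S_d.+1) (i : 'I_d).
Variables (p q : seq 'I_d.+1) (s s' : 'I_d.+1).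
Local Notation l := (p ++ s :: s' :: q).
Hypotheses (size_p : size p = i) (l_all : forall x, x \in l).
Hypothesis piE : forall x, pi x = index x l :> nat.
Implicit Type T : osp d.+1.

Lemma seq_position x : [\/ x \in p /\ pi x = index x p :> nat,
  x = s /\ pi x = i :> nat, x = s' /\ pi x = i.+1 :> nat |
  x \in q /\ pi x = (i + (index x q).+2)%N :> nat].
Proof.
have := l_all x; rewrite piE index_cat mem_cat.
case: (boolP (x \in p)) => [xp _|xp]; first by constructor 1.
rewrite !inE /= size_p => /or3P h.
have [xs|xs] := eqVneq s x; first by constructor 2; rewrite addn0.
have [xs'|xs'] := eqVneq s' x; first by constructor 3; rewrite addn1.
constructor 4; split=> //; case: h => // /eqP xE.
  by rewrite xE eqxx in xs.
by rewrite xE eqxx in xs'.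
Qed.

Lemma seq_cutT T : blocks T = [seq [set x] | x <- p] ++
    [:: [set s]; [set s']] ++ [seq [set x] | x <- q] ->
  T = cut pi setT.
Proof.
move=> TE; have {}TE : blocks T = [seq [set x] | x <- l] by rewrite TE map_cat.
apply: lv_inj => x; rewrite lv_cut level_setT -1?ltnS // piE.
have xl : (index x l < size l)%N by rewrite index_mem.
by apply: lv_eq; rewrite TE ?size_map // (nth_map x) // nth_index // set11.
Qed.

Lemma seq_cut_swap T : blocks T = [seq [set x] | x <- p] ++
    [:: [set s']; [set s]] ++ [seq [set x] | x <- q] ->
  T = cut (swap pi i) setT.
Proof.
move=> TE; apply: lv_inj => x; rewrite lv_cut level_setT -1?ltnS // swapE.
apply: lv_eq; rewrite TE.
  rewrite !size_cat !size_map /= size_p.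
  case: (seq_position x) => -[xx ->].
  - have : (index x p < i)%N by rewrite -size_p index_mem.
    by do 2?case: eqP => ?; lia.
  - by rewrite eqxx; lia.
  - by rewrite eqxx; case: eqP; lia.
  have -> : (i + (index x q).+2 == i)%N = false by lia.
  have -> : (i + (index x q).+2 == i.+1)%N = false by lia.
  by rewrite ltn_add2l add2n !ltnS index_mem.
rewrite nth_cat size_map size_p; case: (seq_position x) => -[xx ->].
- have xp : (index x p < i)%N by rewrite -size_p index_mem.
  rewrite !ltn_eqF //; last exact: ltnW.
  by rewrite xp (nth_map x) ?index_mem // nth_index // set11.
- by rewrite eqxx ltnNge leqnSn /= subSnn /= xx set11.
- by rewrite eqxx gtn_eqF // ltnn subnn /= xx set11.
rewrite !gtn_eqF ?ltnNge ?leq_addr //=; try lia.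
by rewrite addKn /= (nth_map x) ?index_mem // nth_index // set11.
Qed.

Lemma seq_cutC1 T : blocks T = [seq [set x] | x <- p] ++
    [set s; s'] :: [seq [set x] | x <- q] ->
  T = cut pi (~: [set i]).
Proof.
move=> TE; apply: lv_inj => x; rewrite lv_cut level_setC1; last by rewrite -ltnS.
apply: lv_eq; rewrite TE.
  rewrite size_cat /= !size_map size_p.
  case: (seq_position x) => -[xx ->].
  - have : (index x p < i)%N by rewrite -size_p index_mem.
    lia.
  - lia.
  - lia.
  have -> : (i + (index x q).+2 - (i < i + (index x q).+2) =
             i + (index x q).+1)%N by lia.
  by rewrite ltn_add2l ltnS index_mem.
rewrite nth_cat size_map size_p; case: (seq_position x) => -[xx ->].
- have xp : (index x p < i)%N by rewrite -size_p index_mem.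
  have -> : (i < index x p)%N = false by lia.
  rewrite subn0 xp.
  by rewrite (nth_map x) ?index_mem // nth_index // set11.
- by rewrite ltnn subn0 ltnn subnn /= xx set21.
- by rewrite ltnSn subSS subn0 ltnn subnn /= xx set22.
have -> : (i + (index x q).+2 - (i < i + (index x q).+2) = i + (index x q).+1)%N.
  by lia.
have -> : (i + (index x q).+1 < i)%N = false by lia.
by rewrite addKn /= (nth_map x) ?index_mem // nth_index // set11.
Qed.

(** Dropping the block of an empty [p] matches the missing left neighbour of [i] when [i] is 0, and
    an empty [q] likewise concerns the right one. *)
Lemma seq_cut_neighbours T : blocks T =
    [seq B <- [:: [set x in p]; [set s; s']; [set x in q]] | B != set0] ->
  T = cut pi (neighbours i).
Proof.
rewrite set2_seq -[[:: _; _; _]]/[seq [set x in t] | t <- [:: p; [:: s; s']; q]].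
rewrite filter_set_seq => TE; apply: lv_inj => x; rewrite lv_cut.
rewrite level_neighbours; last by rewrite -ltnS.
have i_gt0 : (0 < i)%N = (p != [::]) by rewrite -size_p; case: (p).
rewrite i_gt0; case: (seq_position x) => -[xx ->].
- have xi : (index x p < i)%N by rewrite -size_p index_mem.
  have -> : ((p != [::]) && (i <= index x p) + (i.+1 < index x p) = 0)%N by lia.
  have p0 : p != [::] by rewrite -i_gt0; lia.
  by apply: lv_eq; rewrite TE /= p0 //= inE.
- have -> : ((p != [::]) && (i <= i) + (i.+1 < i) = (p != [::]))%N by lia.
  by apply: lv_eq; rewrite TE /=; do 2!case: eqP => _; rewrite //= !inE xx eqxx.
- have -> : ((p != [::]) && (i <= i.+1) + (i.+1 < i.+1) = (p != [::]))%N by lia.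
  by apply: lv_eq; rewrite TE /=; do 2!case: eqP => _;
    rewrite //= !inE xx eqxx orbT.
have -> : ((p != [::]) && (i <= i + (index x q).+2) +
           (i.+1 < i + (index x q).+2) = (p != [::]).+1)%N by lia.
have q0 : q != [::] by apply: contraTneq xx => ->.
by apply: lv_eq; rewrite TE /= q0; case: eqP => _; rewrite //= !inE xx.
Qed.

End WallsFromSeqs.

(** The word p s s' q and the pair ([pi], [i]) carry the same data: [pi] gives the position of each
    letter and [i] is the length of [p]. The extra top term is 0 in both of its cases. *)
Lemma essential_inequalitiesP (R : realType) d (b : osp_bar d -> R) :
  essential_inequalities b <-> forall pi i,
    2 * bext b (cut pi (~: [set i])) + bext b (cut pi (neighbours i)) <=
    bext b (cut pi setT) + bext b (cut (swap pi i) setT).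
Proof.
have top0 (r : seq 'I_d.+1) : (if r is [::] then 0 else bext b (osp_top d)) = 0.
  by case: r => [|? ?]; rewrite ?bext_top.
split=> [ess pi i|ess T T0 T0' S p q s s' _ TE T0E T0'E SE].
(* The word of [pi] is split around positions i and i + 1, and the four partitions are then built
   from the pieces. *)
- pose l := [seq (pi^-1)%g k | k <- enum 'I_d.+1].
  have size_l : size l = d.+1 by rewrite size_map size_enum_ord.
  have l_uniq : uniq l by rewrite map_inj_uniq ?enum_uniq //; apply: perm_inj.
  have l_all x : x \in l.
    by rewrite -(permK pi x); apply: map_f; rewrite mem_enum.
  have piE x : pi x = index x l :> nat.
    by rewrite -{2}(permK pi x) (index_map (@perm_inj _ _)) index_enum_ord.
  pose s := nth ord0 l i; pose s' := nth ord0 l i.+1.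
  pose p := take i l; pose q := drop i.+2 l.
  have lE : l = p ++ s :: s' :: q.
    rewrite -[LHS](cat_take_drop i l) (drop_nth ord0) ?(drop_nth ord0 (n := i.+1)) //;
    by have := ltn_ord i; rewrite size_l; lia.
  have size_p : size p = i by rewrite size_takel // size_l leqW // ltnW.
  clearbody p q s s'; rewrite lE in l_uniq l_all piE.
  have osp ls : [::] \notin ls -> perm_eq (flatten ls) (p ++ s :: s' :: q) ->
      is_osp [seq [set x in t] | t <- ls].
    move=> ls0 lsE; apply: osp_of_seqs => // [|x]; first by rewrite (perm_uniq lsE).
    by rewrite (perm_mem lsE).
  have nil1 (r : seq 'I_d.+1) : ([::] \in [seq [:: x] | x <- r]) = false.
    by apply/negbTE/negP => /mapP[].
  have ospT : is_osp ([seq [set x] | x <- p] ++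
      [set s; s'] :: [seq [set x] | x <- q]).
    rewrite !map_set1 set2_seq -map_cons -map_cat; apply: osp.
      by rewrite mem_cat inE !nil1.
    by rewrite flatten_cat /= !flatten_seq1.
  have ospT0 : is_osp ([seq [set x] | x <- p] ++
      [:: [set s]; [set s']] ++ [seq [set x] | x <- q]).
    rewrite -[[:: _; _] ++ _]/(map set1 (s :: s' :: q)) -map_cat map_set1.
    by apply: osp; rewrite ?nil1 // flatten_seq1.
  have ospT0' : is_osp ([seq [set x] | x <- p] ++
      [:: [set s']; [set s]] ++ [seq [set x] | x <- q]).
    rewrite -[[:: _; _] ++ _]/(map set1 (s' :: s :: q)) -map_cat map_set1.
    apply: osp; rewrite ?nil1 // flatten_seq1 perm_cat2l.
    by rewrite -[s :: s' :: q]/([:: s; s'] ++ q) -[s' :: s :: q]/([:: s'; s] ++ q)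
               perm_cat2r (perm_catC [:: s'] [:: s]).
  have ospS : is_osp [seq B <- [:: [set x in p]; [set s; s']; [set x in q]]
                 | B != set0].
    rewrite set2_seq.
    rewrite -[[:: _; _; _]]/[seq [set x in t] | t <- [:: p; [:: s; s']; q]].
    rewrite filter_set_seq; apply: osp; first by rewrite mem_filter.
    by case: (p) => [|? ?]; case: (q) => [|? ?]; rewrite /= ?cats0.
  have rkT : osp_rank (Osp ospT) = 1%N.
    rewrite /osp_rank /= size_cat /= !size_map.
    by move: size_l; rewrite lE size_cat /=; lia.
  have := ess (Osp ospT) (Osp ospT0) (Osp ospT0') (Osp ospS) p q s s' rkT
              erefl erefl erefl erefl.
  rewrite (seq_cutT l_all piE (erefl (blocks (Osp ospT0)))).
  rewrite (seq_cut_swap size_p l_all piE (erefl (blocks (Osp ospT0')))).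
  rewrite (seq_cutC1 size_p l_all piE (erefl (blocks (Osp ospT)))).
  rewrite (seq_cut_neighbours size_p l_all piE (erefl (blocks (Osp ospS)))).
  by rewrite top0 addr0.
have l_uniq : uniq (p ++ s :: s' :: q).
  case/and3P: (ospP T0) => _ + _.
  rewrite T0E -[_ ++ _ ++ _]/(_ ++ map set1 (s :: s' :: q)) -map_cat.
  rewrite (pairwise_map (fun x : 'I_d.+1 => [set x])) uniq_pairwise.
  by apply: sub_pairwise => x y /=; rewrite disjoints1 inE.
have l_all x : x \in p ++ s :: s' :: q.
  case/and3P: (ospP T0) => _ _ /eqP/setP/(_ x).
  rewrite T0E -[_ ++ _ ++ _]/(_ ++ map set1 (s :: s' :: q)) -map_cat.
  rewrite inE bigcup_seq => /bigcupP[B /mapP[y yl ->]].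
  by rewrite inE => /eqP ->.
have size_l : size (p ++ s :: s' :: q) = d.+1.
  rewrite -(card_uniqP l_uniq) -[RHS]card_ord; apply: eq_card => x.
  by rewrite l_all.
have lt_l x : (index x (p ++ s :: s' :: q) < d.+1)%N.
  by rewrite -[X in (_ < X)%N]size_l index_mem.
have f_inj : injective (fun x => Ordinal (lt_l x)).
  by move=> x y /(congr1 val) /= /(congr1 (nth x (p ++ s :: s' :: q))); rewrite !nth_index.
have piE x : perm f_inj x = index x (p ++ s :: s' :: q) :> nat by rewrite permE.
have lt_p : (size p < d)%N.
  by move: size_l; rewrite size_cat /=; lia.
have size_p : size p = Ordinal lt_p by [].
rewrite (seq_cutT l_all piE T0E) (seq_cut_swap size_p l_all piE T0'E).
rewrite (seq_cutC1 size_p l_all piE TE) (seq_cut_neighbours size_p l_all piE SE).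
by rewrite top0 addr0.
Qed.

(** * The two families of inequalities against the bounds at all cone points *)

Section GlobalInequalities.
Variables (R : realType) (d : nat) (b : osp_bar d -> R).
Implicit Types (pi : 'S_d.+1) (tau : 'S_d) (T : osp d.+1) (y z : 'rV[R]_d.+1).
Local Notation e pi A := (osp_vec R (cut pi A)).
Hypothesis sub : local_submodularity b.

(* Modulo the all-ones vector, [e_T0 + e_T0' = 2 e_T + e_S]. *)
Lemma pairing_swap pi i z : Vd z ->
  pairing (e pi setT) z + pairing (e (swap pi i) setT) z =
  2 * pairing (e pi (~: [set i])) z + pairing (e pi (neighbours i)) z.
Proof.
move=> z0; rewrite !pairing_osp_vec // mulr_sumr -!big_split /=.
have c0 : \sum_x (i == 0%N :> nat)%:R * z 0 x = 0.
  by rewrite -mulr_sumr [X in _ * X]z0 mulr0.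
rewrite -[RHS]addr0 -[X in _ + X]c0 -big_split; apply: eq_bigr => x _ /=.
by rewrite -mulrDl -natrD level_swap mul2n -addnn !natrD; ring.
Qed.

(** Apply [pairing_swap] to the point of the swapped cone. There T0' and T take their exact values
    and S obeys the greedy bound, so the essential inequality bounds the remaining term, T0. *)
Lemma swap_ray_le pi tau i : essential_inequalities b -> tau i = 0%N :> nat ->
  cone_extension b (swap pi i) tau (e pi setT) <= bext b (cut pi setT).
Proof.
move=> /essential_inequalitiesP ess i0.
have := pairing_swap pi i (cone_point_Vd b (swap pi i) tau).
rewrite !pairing_cone_point.
rewrite -(@cut_swap _ pi i (~: [set i])) ?inE ?eqxx //.
rewrite -(@cut_swap _ pi i (neighbours i)) ?notin_neighbours //.
(* The full cut set and the complement of [i] are upper sets for [tau], because [i] comes first. *)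
rewrite [X in _ + X]cone_extension_ray; last first.
  by apply: nested_cone_cut => j k _; rewrite !inE.
rewrite [cone_extension _ _ _ (e _ (~: _))]cone_extension_ray; last first.
  apply: nested_cone_cut => j k jk; rewrite !inE; apply: contraNN => /eqP ki.
  move: jk; rewrite -(permKV tau k) ki i0 leqn0 => /eqP j0.
  apply/eqP; apply: (@perm_inj _ tau); apply: val_inj.
  by rewrite /= permKV i0.
have := cone_extension_le (swap pi i) tau (neighbours i) sub.
have := ess pi i.
rewrite -(@cut_swap _ pi i (~: [set i])) ?inE ?eqxx //.
rewrite -(@cut_swap _ pi i (neighbours i)) ?notin_neighbours //.
lra.
Qed.

(** The cones of [pi] and of [swap pi i] share all chain rays except that of the full cut set. The
    difference of the values is thus the gap at [i] times the slack in [swap_ray_le], a product of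
    two nonpositive numbers. *)
Lemma cone_extension_swap_le pi tau i y : essential_inequalities b ->
  tau i = 0%N :> nat -> gap pi y i <= 0 ->
  cone_extension b pi tau y <= cone_extension b (swap pi i) tau y.
Proof.
move=> ess i0 gi; rewrite (cone_extension_gap b pi tau (swap pi i) tau y) -subr_ge0 -sumrB.
have same k : cone_extension b (swap pi i) tau (e pi (chain tau k.+1)) =
              bext b (cut pi (chain tau k.+1)).
  rewrite -(@cut_swap _ pi i); last by rewrite inE i0.
  by rewrite cone_extension_ray //; apply: nested_cone_chain.
rewrite (bigD1 (tau i)) //= big1 ?addr0 => [|k ki]; last first.
  have : k != 0%N :> nat by apply: contraNneq ki => k0; apply/eqP/val_inj; rewrite /= i0.
  case: k {ki} => -[//|k] kd _.
  rewrite -[nat_of_ord _]/k.+1 !same; ring.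
rewrite permK i0 chain0 same -mulrBr.
have := swap_ray_le pi ess i0; have := gi; nra.
Qed.

Lemma swap_ord_weight pi i y : gap pi y i < 0 ->
  \sum_(k < d.+1) k%:R * y 0 ((pi^-1)%g k) <
  \sum_(k < d.+1) k%:R * y 0 (((swap pi i)^-1)%g k).
Proof.
move=> gi.
have sumE (s : 'S_d.+1) : \sum_(k < d.+1) k%:R * y 0 ((s^-1)%g k) =
    \sum_x (s x)%:R * y 0 x.
  rewrite (reindex_inj (@perm_inj _ s)).
  by apply: eq_bigr => x _; rewrite permK.
rewrite !sumE -subr_gt0 -sumrB; move: gi; rewrite /gap.
set x1 := (pi^-1)%g _; set x0 := (pi^-1)%g _ => gi.
have px1 : pi x1 = i.+1 :> nat by rewrite permKV.
have px0 : pi x0 = i :> nat by rewrite permKV.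
have ne : x1 != x0 by apply: contra_eq_neq px1 => ->; rewrite px0 ltn_eqF.
rewrite (bigD1 x0) //= (bigD1 x1) //= big1 ?addr0 => [|x /andP[xx0 xx1]].
  rewrite !swapE px0 px1 eqxx gtn_eqF // eqxx -!(addn1 i) natrD; nra.
rewrite swapE; case: eqP => [h|_].
  by case/eqP: xx0; apply: (@perm_inj _ pi); apply: val_inj; rewrite /= h px0.
case: eqP => [h|_]; last by rewrite subrr.
by case/eqP: xx1; apply: (@perm_inj _ pi); apply: val_inj; rewrite /= h px1.
Qed.

Lemma cone_extension_le_global pi tau T : essential_inequalities b ->
  cone_extension b pi tau (osp_vec R T) <= bext b T.
Proof.
move=> ess; set y := osp_vec R T; set c := cone_extension b pi tau y.
pose P (s : 'S_d.+1) := [exists t, c <= cone_extension b s t y].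
pose w (s : 'S_d.+1) := \sum_(k < d.+1) k%:R * y 0 ((s^-1)%g k).
have P0 : P pi by apply/existsP; exists tau.
(* Instead of iterating exchanges, take a permutation of maximal weight among those reaching at
   least the value [c]. *)
have [s /existsP[t ct] s_max] := @arg_maxP _ R _ pi P w P0.
have [t' t'_srt] := exists_sorting (gap s y).
apply: (le_trans ct); apply: (le_trans (cone_extension_sorted_le _ sub t'_srt)).
have [gap_ge0|] := boolP [forall i, 0 <= gap s y i].
  have [A TA] : exists A, T = cut s A.
    apply: (@sorted_osp_cut R) => i j; rewrite -/y => ij.
    rewrite (coord_gap s y (_ i)) (coord_gap s y (_ j)) lerD2l; apply: ler_sum => k _.
    apply: ler_wpM2l; first exact: (forallP gap_ge0).
    by rewrite !permKV ler_nat; case: ltnP => // /leq_trans -> //.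
  by rewrite /y TA; apply: cone_extension_le.
rewrite negb_forall => /existsP[j]; rewrite -ltNge => gj.
have d_gt0 : (0 < d)%N by case: (j) => m; case: (d).
(* The position of the smallest gap, negative because some gap is. Exchanging there keeps the value
   at least [c] and increases the weight, against maximality. *)
pose i := (t'^-1)%g (Ordinal d_gt0).
have i0 : t' i = 0%N :> nat by rewrite permKV.
have gi : gap s y i < 0.
  by apply: le_lt_trans gj; rewrite -(permK t' j) t'_srt.
have := swap_ord_weight gi; rewrite -/(w s) -/(w (swap s i)) ltNge.
case/negP; apply: s_max.
apply/existsP; exists t'; apply: (le_trans ct).
apply: (le_trans (cone_extension_sorted_le _ sub t'_srt)).
exact: cone_extension_swap_le (ltW gi).
Qed.

End GlobalInequalities.

Lemma global_inequalitiesP (R : realType) d (b : osp_bar d -> R) :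
  local_submodularity b /\ essential_inequalities b <->
  forall pi tau T, cone_extension b pi tau (osp_vec R T) <= bext b T.
Proof.
split=> [[sub ess] pi tau T|glob]; first exact: cone_extension_le_global.
split.
- apply/local_submodularityP => pi A B.
  (* Sorting by the number of the two sets containing a position makes both the intersection and the
     union upper sets, so both are rays of one cone. *)
  have [tau srt] := exists_sorting (fun i => (i \in A)%:R + (i \in B)%:R : R).
  have up (i j : 'I_d) : (i <= j)%N ->
      ((((tau^-1)%g i \in A) + ((tau^-1)%g i \in B))%N <=
       ((tau^-1)%g j \in A) + ((tau^-1)%g j \in B))%N.
    by move=> /srt; rewrite -!natrD ler_nat.
  have rI := @cone_extension_ray _ _ b pi tau (cut pi (A :&: B)).
  have rU := @cone_extension_ray _ _ b pi tau (cut pi (A :|: B)).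
  rewrite -rI; last first.
    by apply: nested_cone_cut => i j /up; rewrite !inE; do 4!case: (_ \in _).
  rewrite -rU; last first.
    by apply: nested_cone_cut => i j /up; rewrite !inE; do 4!case: (_ \in _).
  apply: le_trans (lerD (glob pi tau _) (glob pi tau _)).
  rewrite -!pairing_cone_point !pairing_osp_vec; try exact: cone_point_Vd.
  rewrite -!big_split /=; apply: ler_sum => x _.
  rewrite -!mulrDl -!natrD !lv_cut.
  by rewrite levelUI.
- apply/essential_inequalitiesP => pi i.
  (* The key is 0 at [i], 2 at its neighbours and 1 elsewhere: the cut sets of S, T and T0 are then
     upper sets, and only T0' needs the assumed bound. *)
  pose key (j : 'I_d) : R := if j == i then 0 else (1 + (j \in neighbours i))%:R.
  have [tau srt] := exists_sorting key.
  have := pairing_swap pi i (cone_point_Vd b pi tau).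
  rewrite !pairing_cone_point.
  have ray (A : {set 'I_d}) : (forall j k, key j <= key k -> j \in A -> k \in A) ->
      cone_extension b pi tau (osp_vec R (cut pi A)) = bext b (cut pi A).
    move=> up; apply: cone_extension_ray; apply: nested_cone_cut => j k jk.
    by apply: up; apply: srt.
  rewrite !ray; first 1 last.
  + move=> j k; rewrite /key; case: (j =P i) => [->|_].
      by rewrite (negbTE (notin_neighbours i)).
    move=> + jN; rewrite jN; case: ifP => _.
      by rewrite lern0.
    by rewrite ler_nat; case: (k \in _).
  + move=> j k; rewrite /key !inE; case: (j =P i) => // _.
    by case: (k =P i) => // _; rewrite lern0.
  + by move=> j k _; rewrite !inE.
  have := glob pi tau (cut (swap pi i) setT); lra.
Qed.

(** * Deforming vectors through the points of the maximal cones *)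

Section Deformations.
Local Open Scope classical_set_scope.
Variables (R : realType) (d : nat).
Local Notation vec := 'rV[R]_d.+1.
Implicit Types (pi : 'S_d.+1) (tau : 'S_d) (T : osp d.+1) (v w x y z : vec).
Implicit Types (b : osp_bar d -> R) (P : set vec).
Local Notation e pi A := (osp_vec R (cut pi A)).
Local Notation ray := (fun T : osp_bar d => osp_vec R (val T)).

Lemma bext_val b (T : osp_bar d) : bext b (val T) = b T.
Proof. by rewrite /bext valK. Qed.

Lemma bext_ind b (Q : osp d.+1 -> R -> Prop) : Q (osp_top d) 0 ->
  (forall T : osp_bar d, Q (val T) (b T)) -> forall T, Q T (bext b T).
Proof.
move=> Q0 Qb T; rewrite /bext; case: insubP => [T' _ <- //|].
by rewrite negbK => /eqP ->.
Qed.

Lemma pairing_top z : Vd z -> pairing (osp_vec R (osp_top d)) z = 0.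
Proof.
by move=> z0; rewrite pairing_osp_vec // big1 // => x _; rewrite lv_top mul0r.
Qed.

Lemma pairing_suml (I : finType) (f : I -> vec) z :
  pairing (\sum_i f i) z = \sum_i pairing (f i) z.
Proof.
rewrite /pairing exchange_big; apply: eq_bigr => x _ /=.
by rewrite summxE mulr_suml.
Qed.

Lemma pairingBr w x y : pairing w (x - y) = pairing w x - pairing w y.
Proof.
rewrite /pairing -sumrB; apply: eq_bigr => j _.
by rewrite !mxE mulrBr.
Qed.

Lemma VdB x y : Vd x -> Vd y -> Vd (x - y).
Proof.
rewrite /Vd /= => x0 y0; under eq_bigr do rewrite !mxE.
by rewrite sumrB x0 y0 subrr.
Qed.

(** The rays of a maximal cone span W_d: [pairing_gap] recovers every coordinate of a point of V_d
    from its pairings with them. *)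
Lemma chain_separates pi tau x y : Vd x -> Vd y ->
  (forall k : 'I_d, pairing (e pi (chain tau k)) x =
                    pairing (e pi (chain tau k)) y) -> x = y.
Proof.
move=> x0 y0 xy; have z0 := VdB x0 y0.
have zk (k : nat) : (k <= d)%N -> pairing (e pi (chain tau k)) (x - y) = 0.
  rewrite leq_eqVlt => /orP[/eqP->|kd]; first by rewrite chaind cut0 pairing_top.
  by rewrite pairingBr (xy (Ordinal kd)) subrr.
apply/eqP; rewrite -subr_eq0; apply/eqP/rowP => j; rewrite [RHS]mxE.
have <- : pairing (delta_mx 0 j) (x - y) = (x - y) 0 j.
  rewrite /pairing (bigD1 j) //= big1 => [|i ne].
    by rewrite mxE !eqxx mul1r addr0.
  by rewrite mxE eqxx (negbTE ne) mul0r.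
rewrite (pairing_gap pi tau) // big1 // => k _.
by rewrite !zk ?subrr ?mulr0 // ltnW.
Qed.

Lemma nested_cone_cover w : exists pi tau, nested_braid_cone pi tau w.
Proof.
have [pi pi_srt] := exists_sorting (fun j => w 0 j).
have [tau tau_srt] := exists_sorting (gap pi w).
by exists pi, tau.
Qed.

Lemma pairing0r x : pairing x (0 : vec) = 0.
Proof. by rewrite /pairing big1 // => j _; rewrite mxE mulr0. Qed.

Lemma vertex_of_cone P pi tau : P `<=` @Vd R d ->
  normal_fan P = nested_braid_fan R d ->
  exists2 v, is_vertex P v & normal_cone P [set v] = nested_braid_cone pi tau.
Proof.
move=> P_Vd P_fan.
have : nested_braid_fan R d (nested_braid_cone pi tau).
  (* The zero functional exhibits the cone as a face of itself. *)
  exists pi, tau, 0; split.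
  - by rewrite /Vd /= big1 // => j _; rewrite mxE.
  - by move=> w _; rewrite pairing0r.
  - by apply/seteqP; split=> [w|w []] //=; rewrite pairing0r.
rewrite -P_fan => -[F [[v Fv] [w FE]] CE].
have FP x : F x -> P x by rewrite FE => -[].
have Fv1 : F = [set v].
  apply/seteqP; split=> [x Fx|x ->] //=.
  apply: (chain_separates (pi := pi) (tau := tau)); try exact: P_Vd (FP _ _).
  move=> k; have : normal_cone P F (e pi (chain tau k)).
    by rewrite -CE; apply: nested_cone_chain.
  by move=> nc; apply/eqP; rewrite eq_le !nc //; apply: FP.
by exists v; [split; [exists v|exists w; rewrite -FE] | rewrite -Fv1].
Qed.

(** A functional exposing [v] lies in some maximal cone. The vertex of that cone also maximizes it,
    and therefore equals [v]. *)
Lemma cone_of_vertex P v : P `<=` @Vd R d ->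
  normal_fan P = nested_braid_fan R d -> is_vertex P v ->
  exists pi tau, normal_cone P [set v] = nested_braid_cone pi tau.
Proof.
move=> P_Vd P_fan [_ [w vE]].
have [pi [tau w_cone]] := nested_cone_cover w.
have [v' [_ [w' v'E]] v'_cone] := vertex_of_cone pi tau P_Vd P_fan.
exists pi, tau; rewrite -v'_cone; congr (normal_cone _ [set _]).
have Pv' : P v' by have : [set v'] v' by []; rewrite v'E => -[].
suff : [set v] v' by [].
rewrite vE; split=> // y Py.
by move: w_cone; rewrite -v'_cone; apply.
Qed.

Lemma face_in_directionE P v w : P v ->
  face_in_direction P w v <-> normal_cone P [set v] w.
Proof.
by move=> Pv; split=> [[_ h] x y -> //|h]; [exact: h|split=> // y; apply: h].
Qed.

Lemma vertex_in P v : is_vertex P v -> P v.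
Proof. by case=> _ [w vE]; have : [set v] v by []; rewrite vE => -[]. Qed.

Lemma cone_point_vertex b pi tau :
  (forall T, cone_extension b pi tau (osp_vec R T) <= bext b T) ->
  is_vertex (Qpoly ray b) (cone_point b pi tau).
Proof.
move=> glob; set u := cone_point b pi tau.
have u0 : Vd u by apply: cone_point_Vd.
have Qu : Qpoly ray b u.
  by split=> // T; rewrite pairing_cone_point (le_trans (glob _)) ?bext_val.
have Qb x T : Qpoly ray b x -> pairing (osp_vec R T) x <= bext b T.
  move=> [x0 xb].
  apply: (@bext_ind b (fun T r => pairing (osp_vec R T) x <= r)) => //.
  by rewrite pairing_top.
have ub k : pairing (e pi (chain tau k)) u = bext b (cut pi (chain tau k)).
  by rewrite pairing_cone_point cone_extension_ray //; apply: nested_cone_chain.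
split; first by exists u.
(* The sum of the rays exposes the point: it attains the bound of every ray, so any other maximizer
   must attain all of them too. *)
exists (\sum_(k < d) e pi (chain tau k)); apply/seteqP; split=> [x ->|x [Qx xmax]].
  split=> // y Qy; rewrite !pairing_suml; apply: ler_sum => k _.
  by rewrite ub Qb.
apply: (chain_separates (pi := pi) (tau := tau)) => // [|k]; first by case: Qx.
have sum_ge0 := xmax _ Qu; rewrite 2!pairing_suml -subr_ge0 -sumrB in sum_ge0.
have le0 (j : 'I_d) : true ->
    0 <= pairing (e pi (chain tau j)) u - pairing (e pi (chain tau j)) x.
  by rewrite subr_ge0 ub => _; apply: Qb.
have /psumr_eq0P : \sum_(j < d) (pairing (e pi (chain tau j)) u -
                         pairing (e pi (chain tau j)) x) = 0.
  apply/eqP; rewrite eq_le sumr_ge0 // andbT -oppr_ge0 -sumrN.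
  by under eq_bigr do rewrite opprB.
by move=> /(_ le0) /(_ k isT) /subr0_eq/esym.
Qed.

(** The hyperplanes at a vertex are those of the rays in its normal cone, and they meet exactly in
    the cone point. Being deforming therefore means that every cone point satisfies all inequalities
    of [Qpoly]; it is then automatically a vertex by [cone_point_vertex]. *)
Lemma is_deformingP P b : P `<=` @Vd R d ->
  normal_fan P = nested_braid_fan R d ->
  is_deforming ray P b <->
  forall pi tau T, cone_extension b pi tau (osp_vec R T) <= bext b T.
Proof.
move=> P_Vd P_fan; split=> [def pi tau T|glob v Pv].
  have [v Pv vE] := vertex_of_cone pi tau P_Vd P_fan.
  have [u /vertex_in[u0 Qu] uE] := def v Pv.
  have uP : cone_point b pi tau = u.
    suff : [set u] (cone_point b pi tau) by [].
    rewrite -uE; split=> [|T']; first exact: cone_point_Vd.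
    rewrite face_in_directionE ?vE; last exact: vertex_in Pv.
    by move=> T'_cone; rewrite pairing_cone_point cone_extension_ray ?bext_val.
  rewrite -pairing_cone_point uP.
  apply: (@bext_ind b (fun T r => pairing (osp_vec R T) u <= r)) => //.
  by rewrite pairing_top.
have [pi [tau vE]] := cone_of_vertex P_Vd P_fan Pv.
exists (cone_point b pi tau); first exact: cone_point_vertex.
apply/seteqP; split=> [x [x0 xb]|x ->] /=.
  apply: (chain_separates (pi := pi) (tau := tau)) => // [|k].
    exact: cone_point_Vd.
  rewrite pairing_cone_point cone_extension_ray; last exact: nested_cone_chain.
  have := nested_cone_chain R pi tau k.
  apply: (@bext_ind b (fun T r => nested_braid_cone pi tau (osp_vec R T) ->
                       pairing (osp_vec R T) x = r)) => [|T' T'_cone].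
    by rewrite pairing_top.
  by apply: xb; rewrite face_in_directionE ?vE //; apply: vertex_in Pv.
split=> [|T']; first exact: cone_point_Vd.
rewrite face_in_directionE ?vE; last exact: vertex_in Pv.
by move=> T'_cone; rewrite pairing_cone_point cone_extension_ray ?bext_val.
Qed.

End Deformations.

Local Open Scope classical_set_scope.

Theorem theorem4p29 (R : realType) (d : nat) (P0 : set 'rV[R]_d.+1)
    (P0_polytope : is_polytope P0) (P0_full : full_dimensional P0)
    (P0_fan : normal_fan P0 = nested_braid_fan R d) :
  deformation_cone (fun T : osp_bar d => osp_vec R (val T)) P0 =
  [set b : osp_bar d -> R | local_submodularity b /\ essential_inequalities b].
Proof.
have [P0_Vd _] := P0_polytope.
by apply/seteqP; split=> b /=;
  rewrite /deformation_cone /= is_deformingP // global_inequalitiesP.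
Qed.
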